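(* Let $\mathbb{C}$ be a modified category of interest. Then the category $\mathbf{PreCat}^{1}(\mathbb{C})$ of precat$^1$-objects in $\mathbb{C}$ and the category $\mathbf{PXMod}(\mathbb{C})$ of precrossed modules in $\mathbb{C}$ are naturally equivalent (i.e. there is an equivalence of categories between them).
   Context: **Modified category of interest.** Let $\mathbb{C}$ be a category of groups with a set of operations $\Omega$ and a set of identities $\mathbb{E}$ (objects are the algebras with operations $\Omega$ satisfying $\mathbb{E}$, morphisms are the maps preserving all operations), where $\mathbb{E}$ includes the group identities. Let $\Omega_i$ be the set of $i$-ary operations in $\Omega$. $\mathbb{C}$ is a modified category of interest if: (a) $\Omega=\Omega_0\cup\Omega_1\cup\Omega_2$; (b) the group operations, written additively $0,-,+$ (the group need not be commutative), are elements of $\Omega_0,\Omega_1,\Omega_2$ respectively; with $\Omega_2'=\Omega_2\setminus\{+\}$ and $\Omega_1'=\Omega_1\setminus\{-\}$, if $\ast\in\Omega_2'$ then $\Omega_2'$ contains $\ast^\circ$ defined by $x\ast^\circ y=y\ast x$; and $\Omega_0=\{0\}$; (c) for each $\ast\in\Omega_2'$, $\mathbb{E}$ includes $x\ast(y+z)=x\ast y+x\ast z$; (d) for each $\omega\in\Omega_1'$ and $\ast\in\Omega_2'$, $\mathbb{E}$ includes $\omega(x+y)=\omega(x)+\omega(y)$ and $\omega(x\ast y)=\omega(x)\ast\omega(y)$; and for every object $C$ and $x_1,x_2,x_3\in C$: (Axiom 1) $x_1+(x_2\ast x_3)=(x_2\ast x_3)+x_1$ for each $\ast\in\Omega_2'$;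 (Axiom 2) for each ordered pair $(\ast,\overline{\ast})\in\Omega_2'\times\Omega_2'$ there is a word $W$ such that $(x_1\ast x_2)\overline{\ast}x_3=W(x_1(x_2x_3),x_1(x_3x_2),(x_2x_3)x_1,(x_3x_2)x_1,x_2(x_1x_3),x_2(x_3x_1),(x_1x_3)x_2,(x_3x_1)x_2)$, where each juxtaposition represents an operation in $\Omega_2'$. **Derived actions.** For a split extension $0\to A\to E\xrightarrow{p}B\to 0$ in $\mathbb{C}$ with section $s:B\to E$ (a morphism with $ps=1_B$), the associated derived action of $B$ on $A$ consists of the maps $b\cdot a=s(b)+a-s(b)$ and $b\ast a=s(b)\ast a$ for $a\in A$, $b\in B$, $\ast\in\Omega_2'$ (with $a\ast b$ meaning $b\ast^\circ a$). A derived action of $B$ on $A$ is a set of maps arising in this way from some split extension. **Precrossed modules.** A precrossed module in $\mathbb{C}$ is a triple $(C_1,C_0,\partial)$ where $C_0,C_1\in\mathbb{C}$, $C_0$ has a derived action on $C_1$, and $\partial:C_1\to C_0$ is a morphism in $\mathbb{C}$ with $\partial(c_0\cdot c_1)=c_0+\partial(c_1)-c_0$ and $\partial(c_0\ast c_1)=c_0\ast\partial(c_1)$ for all $c_0\in C_0$, $c_1\in C_1$, $\ast\in\Omega_2'$. A morphism $(C_1,C_0,\partial)\to(C_1',C_0',\partial')$ is a pair $(\mu_1,\mu_0)$ of $\mathbb{C}$-morphisms $\mu_i:C_i\to C_i'$ with $\mu_0\partial=\partial'\mu_1$, $\mu_1(c_0\cdot c_1)=\mu_0(c_0)\cdot\mu_1(c_1)$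 and $\mu_1(c_0\ast c_1)=\mu_0(c_0)\ast\mu_1(c_1)$ for all $c_0,c_1$ and $\ast\in\Omega_2'$. This gives the category $\mathbf{PXMod}(\mathbb{C})$. **Precat$^1$-objects.** A precat$^1$-object in $\mathbb{C}$ is a triple $(C,\omega_0,\omega_1)$, where $C\in\mathbb{C}$ and $\omega_0,\omega_1:C\to C$ are morphisms in $\mathbb{C}$ with $\omega_0\omega_1=\omega_1$ and $\omega_1\omega_0=\omega_0$. Morphisms of precat$^1$-objects are the $\mathbb{C}$-morphisms compatible with the maps $\omega_0$ and $\omega_1$. This gives the category $\mathbf{PreCat}^1(\mathbb{C})$. *)

(* Defs.v *)
From Stdlib Require Import List FunctionalExtensionality ProofIrrelevance.
Import ListNotations.

Set Implicit Arguments.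
Unset Strict Implicit.
Unset Printing Implicit Defensive.

(* Categories, with Leibniz equality of morphisms; [comp g f] is g after f. *)

Record category := Category {
  ob :> Type;
  mor : ob -> ob -> Type;
  idm : forall x, mor x x;
  comp : forall x y z, mor y z -> mor x y -> mor x z;
  comp_id_l : forall x y (f : mor x y), comp (idm y) f = f;
  comp_id_r : forall x y (f : mor x y), comp f (idm x) = f;
  comp_assoc : forall x y z t (h : mor z t) (g : mor y z) (f : mor x y),
    comp h (comp g f) = comp (comp h g) f }.

Arguments idm {c} x.
Arguments comp {c x y z} g f.

Record functor (C D : category) := Functor {
  fob :> C -> D;
  fmor : forall x y, mor x y -> mor (fob x) (fob y);
  fmor_id : forall x, fmor (idm x) = idm (fob x);
  fmor_comp : forall x y z (g : mor y z) (f : mor x y),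
    fmor (comp g f) = comp (fmor g) (fmor f) }.

Arguments fmor {C D} f {x y} m : rename.

Definition functor_id (C : category) : functor C C :=
  @Functor C C (fun x => x) (fun _ _ f => f)
    (fun _ => eq_refl) (fun _ _ _ _ _ => eq_refl).

Lemma functor_comp_id (C D E : category) (G : functor D E) (F : functor C D) x :
  fmor G (fmor F (idm x)) = idm (G (F x)).
Proof. now rewrite !fmor_id. Qed.

Lemma functor_comp_comp (C D E : category) (G : functor D E) (F : functor C D)
    x y z (g : mor y z) (f : mor x y) :
  fmor G (fmor F (comp g f)) = comp (fmor G (fmor F g)) (fmor G (fmor F f)).
Proof. now rewrite !fmor_comp. Qed.

Definition functor_comp (C D E : category) (G : functor D E) (F : functor C D) :
    functor C E :=
  @Functor C E (fun x => G (F x)) (fun _ _ f => fmor G (fmor F f))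
    (functor_comp_id G F) (@functor_comp_comp C D E G F).

Definition is_iso (C : category) (x y : C) (f : mor x y) : Prop :=
  exists g : mor y x, comp g f = idm x /\ comp f g = idm y.

Definition naturally_isomorphic (C D : category) (F G : functor C D) : Prop :=
  exists eta : forall x : C, mor (F x) (G x),
    (forall (x y : C) (f : mor x y),
       comp (eta y) (fmor F f) = comp (fmor G f) (eta x)) /\
    (forall x : C, is_iso (eta x)).

Definition equivalent_categories (C D : category) : Prop :=
  exists (F : functor C D) (G : functor D C),
    naturally_isomorphic (functor_comp G F) (functor_id C) /\
    naturally_isomorphic (functor_comp F G) (functor_id D).

(* A signature lists only the operations beyond 0, - and +: [unary] is
   Omega_1' = Omega_1 \ {-} and [binary] is Omega_2' = Omega_2 \ {+}.  The
   constant 0 is the only nullary operation, and no operation has arity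
   greater than 2. *)
Record signature := Signature { unary : Type; binary : Type }.

Inductive term (S : signature) : Type :=
| Var (n : nat)
| Zero
| Opp (t : term S)
| Add (t u : term S)
| Un (w : unary S) (t : term S)
| Bin (o : binary S) (t u : term S).

Record algebra (S : signature) := Algebra {
  carrier :> Type;
  zero : carrier;
  opp : carrier -> carrier;
  add : carrier -> carrier -> carrier;
  un : unary S -> carrier -> carrier;
  bin : binary S -> carrier -> carrier -> carrier }.

Arguments zero {S a}.
Arguments opp {S a} x : rename.
Arguments add {S a} x y : rename.
Arguments un {S a} w x : rename.
Arguments bin {S a} o x y : rename.

Declare Scope alg_scope.
Delimit Scope alg_scope with alg.
Notation "0" := zero : alg_scope.
Notation "- x" := (opp x) : alg_scope.
Notation "x + y" := (add x y) : alg_scope.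
Notation "x - y" := (add x (opp y)) : alg_scope.
Notation "x *[ o ] y" := (bin o x y)
  (at level 40, o at level 200, left associativity,
   format "x  *[ o ]  y") : alg_scope.
Local Open Scope alg_scope.

Fixpoint eval (S : signature) (A : algebra S) (v : nat -> A) (t : term S) : A :=
  match t with
  | Var _ n => v n
  | Zero _ => 0
  | Opp t => - eval v t
  | Add t u => eval v t + eval v u
  | Un w t => un w (eval v t)
  | Bin o t u => eval v t *[o] eval v u
  end.

Definition identities (S : signature) := term S -> term S -> Prop.

Definition satisfies (S : signature) (A : algebra S) (E : identities S) : Prop :=
  forall t u, E t u -> forall v : nat -> A, eval v t = eval v u.

Record object (S : signature) (E : identities S) := Object {
  alg :> algebra S;
  objectP : satisfies alg E }.

Record is_hom (S : signature) (A B : algebra S) (f : A -> B) : Prop := IsHom {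
  hom_zero : f 0 = 0;
  hom_opp : forall x, f (- x) = - f x;
  hom_add : forall x y, f (x + y) = f x + f y;
  hom_un : forall w x, f (un w x) = un w (f x);
  hom_bin : forall o x y, f (x *[o] y) = f x *[o] f y }.

Record hom (S : signature) (A B : algebra S) := Hom {
  hom_fun :> A -> B;
  homP : is_hom hom_fun }.

Lemma hom_ext (S : signature) (A B : algebra S) (f g : hom A B) :
  (forall x, f x = g x) -> f = g.
Proof.
destruct f as [f Hf], g as [g Hg]; simpl; intros H.
assert (f = g) by now apply functional_extensionality.
subst g; now rewrite (proof_irrelevance _ Hf Hg).
Qed.

Lemma is_hom_id (S : signature) (A : algebra S) : is_hom (fun x : A => x).
Proof. now constructor. Qed.

Lemma is_hom_comp (S : signature) (A B C : algebra S)
    (g : hom B C) (f : hom A B) : is_hom (fun x => g (f x)).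
Proof.
constructor; intros.
- now rewrite (hom_zero (homP f)), (hom_zero (homP g)).
- now rewrite (hom_opp (homP f)), (hom_opp (homP g)).
- now rewrite (hom_add (homP f)), (hom_add (homP g)).
- now rewrite (hom_un (homP f)), (hom_un (homP g)).
- now rewrite (hom_bin (homP f)), (hom_bin (homP g)).
Qed.

Definition hom_id (S : signature) (A : algebra S) : hom A A := Hom (is_hom_id A).

Definition hom_comp (S : signature) (A B C : algebra S)
  (g : hom B C) (f : hom A B) : hom A C := Hom (is_hom_comp g f).

(* That E includes an identity is read as: the identity holds in every object,
   i.e. it is a consequence of E. *)
Record modified_category_of_interest (S : signature) (E : identities S) : Prop :=
  ModifiedCategoryOfInterest {
  mci_addA : forall (C : object E) (x y z : C), x + (y + z) = (x + y) + z;
  mci_add0l : forall (C : object E) (x : C), 0 + x = x;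
  mci_add0r : forall (C : object E) (x : C), x + 0 = x;
  mci_addNl : forall (C : object E) (x : C), - x + x = 0;
  mci_addNr : forall (C : object E) (x : C), x - x = 0;
  mci_opposite : forall o : binary S, exists o' : binary S,
    forall (C : object E) (x y : C), x *[o'] y = y *[o] x;
  mci_binDr : forall (o : binary S) (C : object E) (x y z : C),
    x *[o] (y + z) = x *[o] y + x *[o] z;
  mci_unD : forall (w : unary S) (C : object E) (x y : C),
    un w (x + y) = un w x + un w y;
  mci_unM : forall (w : unary S) (o : binary S) (C : object E) (x y : C),
    un w (x *[o] y) = un w x *[o] un w y;
  mci_axiom1 : forall (o : binary S) (C : object E) (x1 x2 x3 : C),
    x1 + (x2 *[o] x3) = (x2 *[o] x3) + x1;
  (* [p k] and [q k] are the outer and inner operations denoted by the two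
     juxtapositions in the k-th argument of the word; the variables of W beyond
     the eight arguments are evaluated to 0. *)
  mci_axiom2 : forall o1 o2 : binary S,
    exists (W : term S) (p q : nat -> binary S),
    forall (C : object E) (x1 x2 x3 : C),
      (x1 *[o1] x2) *[o2] x3 =
      eval (fun k => nth k
        [ x1 *[p 0%nat] (x2 *[q 0%nat] x3);
          x1 *[p 1%nat] (x3 *[q 1%nat] x2);
          (x2 *[q 2%nat] x3) *[p 2%nat] x1;
          (x3 *[q 3%nat] x2) *[p 3%nat] x1;
          x2 *[p 4%nat] (x1 *[q 4%nat] x3);
          x2 *[p 5%nat] (x3 *[q 5%nat] x1);
          (x1 *[q 6%nat] x3) *[p 6%nat] x2;
          (x3 *[q 7%nat] x1) *[p 7%nat] x2 ] 0) W }.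

Record split_extension (S : signature) (A X B : algebra S)
    (i : hom A X) (p : hom X B) (s : hom B X) : Prop := SplitExtension {
  se_inj : forall a a', i a = i a' -> a = a';
  se_exact : forall x, p x = 0 <-> exists a, i a = x;
  se_surj : forall b, exists x, p x = b;
  se_section : hom_comp p s = hom_id B }.

(* The maps (b, a) |-> b . a and (b, a) |-> b * a; the maps a * b are the
   b *° a, hence are not recorded separately. *)
Record action_maps (S : signature) (B A : algebra S) := ActionMaps {
  dot : B -> A -> A;
  star : binary S -> B -> A -> A }.

(* The kernel A is identified with its image under i in the extension. *)
Definition derived_action (S : signature) (E : identities S) (B A : object E)
    (act : action_maps B A) : Prop :=
  exists (X : object E) (i : hom A X) (p : hom X B) (s : hom B X),
    split_extension i p s /\
    (forall b a, i (dot act b a) = (s b + i a) - s b) /\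
    (forall o b a, i (star act o b a) = s b *[o] i a).

Record precrossed_module (S : signature) (E : identities S) := PrecrossedModule {
  px1 : object E;
  px0 : object E;
  px_act : action_maps px0 px1;
  px_actP : derived_action px_act;
  px_d : hom px1 px0;
  px_d_dot : forall c0 c1, px_d (dot px_act c0 c1) = (c0 + px_d c1) - c0;
  px_d_star : forall o c0 c1, px_d (star px_act o c0 c1) = c0 *[o] px_d c1 }.

Record is_pxhom (S : signature) (E : identities S) (X Y : precrossed_module E)
    (m1 : hom (px1 X) (px1 Y)) (m0 : hom (px0 X) (px0 Y)) : Prop := IsPXHom {
  pxhom_d : hom_comp m0 (px_d X) = hom_comp (px_d Y) m1;
  pxhom_dot : forall c0 c1,
    m1 (dot (px_act X) c0 c1) = dot (px_act Y) (m0 c0) (m1 c1);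
  pxhom_star : forall o c0 c1,
    m1 (star (px_act X) o c0 c1) = star (px_act Y) o (m0 c0) (m1 c1) }.

Record pxhom (S : signature) (E : identities S) (X Y : precrossed_module E) :=
  PXHom {
  pxhom1 : hom (px1 X) (px1 Y);
  pxhom0 : hom (px0 X) (px0 Y);
  pxhomP : is_pxhom pxhom1 pxhom0 }.

Lemma pxhom_ext (S : signature) (E : identities S) (X Y : precrossed_module E)
    (f g : pxhom X Y) :
  (forall x, pxhom1 f x = pxhom1 g x) -> (forall x, pxhom0 f x = pxhom0 g x) ->
  f = g.
Proof.
destruct f as [f1 f0 Hf], g as [g1 g0 Hg]; simpl; intros H1 H0.
apply hom_ext in H1; apply hom_ext in H0; subst g1 g0.
now rewrite (proof_irrelevance _ Hf Hg).
Qed.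

Lemma is_pxhom_id (S : signature) (E : identities S) (X : precrossed_module E) :
  @is_pxhom S E X X (hom_id _) (hom_id _).
Proof. constructor; intros; try apply hom_ext; reflexivity. Qed.

Lemma is_pxhom_comp (S : signature) (E : identities S)
    (X Y Z : precrossed_module E) (g : pxhom Y Z) (f : pxhom X Y) :
  is_pxhom (hom_comp (pxhom1 g) (pxhom1 f)) (hom_comp (pxhom0 g) (pxhom0 f)).
Proof.
destruct f as [f1 f0 [Hf1 Hf2 Hf3]], g as [g1 g0 [Hg1 Hg2 Hg3]].
constructor; simpl; intros.
- apply hom_ext; intros x; simpl.
  generalize (f_equal (fun h => hom_fun h x) Hf1); simpl; intros ->.
  exact (f_equal (fun h => hom_fun h (f1 x)) Hg1).
- now rewrite Hf2, Hg2.
- now rewrite Hf3, Hg3.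
Qed.

Definition pxhom_id (S : signature) (E : identities S)
  (X : precrossed_module E) : pxhom X X := PXHom (is_pxhom_id X).

Definition pxhom_comp (S : signature) (E : identities S)
    (X Y Z : precrossed_module E) (g : pxhom Y Z) (f : pxhom X Y) : pxhom X Z :=
  PXHom (is_pxhom_comp g f).

Definition PXMod (S : signature) (E : identities S) : category.
Proof.
refine (@Category (precrossed_module E) (@pxhom S E) (@pxhom_id S E)
          (@pxhom_comp S E) _ _ _);
  abstract (intros; apply pxhom_ext; reflexivity).
Defined.

Record precat1_object (S : signature) (E : identities S) := Precat1Object {
  pc_obj :> object E;
  pc_w0 : hom pc_obj pc_obj;
  pc_w1 : hom pc_obj pc_obj;
  pc_w01 : hom_comp pc_w0 pc_w1 = pc_w1;
  pc_w10 : hom_comp pc_w1 pc_w0 = pc_w0 }.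

Record is_pchom (S : signature) (E : identities S) (X Y : precat1_object E)
    (f : hom X Y) : Prop := IsPCHom {
  pchom_w0 : hom_comp f (pc_w0 X) = hom_comp (pc_w0 Y) f;
  pchom_w1 : hom_comp f (pc_w1 X) = hom_comp (pc_w1 Y) f }.

Record pchom (S : signature) (E : identities S) (X Y : precat1_object E) :=
  PCHom {
  pchom_hom :> hom X Y;
  pchomP : is_pchom pchom_hom }.

Lemma pchom_ext (S : signature) (E : identities S) (X Y : precat1_object E)
    (f g : pchom X Y) : (forall x, f x = g x) -> f = g.
Proof.
destruct f as [f Hf], g as [g Hg]; simpl; intros H.
apply hom_ext in H; subst g; now rewrite (proof_irrelevance _ Hf Hg).
Qed.

Lemma is_pchom_id (S : signature) (E : identities S) (X : precat1_object E) :
  @is_pchom S E X X (hom_id X).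
Proof. constructor; apply hom_ext; reflexivity. Qed.

Lemma is_pchom_comp (S : signature) (E : identities S)
    (X Y Z : precat1_object E) (g : pchom Y Z) (f : pchom X Y) :
  is_pchom (hom_comp g f).
Proof.
destruct f as [f [Hf0 Hf1]], g as [g [Hg0 Hg1]]; simpl.
constructor; apply hom_ext; intros x; simpl.
- generalize (f_equal (fun h => hom_fun h x) Hf0); simpl; intros ->.
  exact (f_equal (fun h => hom_fun h (f x)) Hg0).
- generalize (f_equal (fun h => hom_fun h x) Hf1); simpl; intros ->.
  exact (f_equal (fun h => hom_fun h (f x)) Hg1).
Qed.

Definition pchom_id (S : signature) (E : identities S)
  (X : precat1_object E) : pchom X X := PCHom (is_pchom_id X).

Definition pchom_comp (S : signature) (E : identities S)
    (X Y Z : precat1_object E) (g : pchom Y Z) (f : pchom X Y) : pchom X Z :=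
  PCHom (is_pchom_comp g f).

Definition PreCat1 (S : signature) (E : identities S) : category.
Proof.
refine (@Category (precat1_object E) (@pchom S E) (@pchom_id S E)
          (@pchom_comp S E) _ _ _);
  abstract (intros; apply pchom_ext; reflexivity).
Defined.

(* Main.v *)
From Stdlib Require Import ClassicalEpsilon ProofIrrelevance.
Require Import Defs.

Set Implicit Arguments.
Unset Strict Implicit.
Unset Printing Implicit Defensive.

Local Open Scope alg_scope.

(** The functor sends [(C, w0, w1)] to the kernel and the fixed points of [w0],
    with the action inside [C] and boundary [w1]. It is an equivalence because
    it is fully faithful and essentially surjective. Both properties rest on
    one fact: in a split extension of [B] by [A] every element is uniquely
    [i a + s b], so [X] has the universal property of the semidirect product,
    i.e. a pair of morphisms out of [A] and [B] compatible with the action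
    glues to a morphism out of [X]. The extension witnessing that an action
    is derived therefore carries the precat1-structure itself, and no algebra
    structure on [A * B] has to be checked against the identities. *)

(** * Equivalences from fully faithful, essentially surjective functors *)

Lemma equivalent_of_fully_faithful_ess_surj (C D : category) (F : functor C D) :
  (forall (x y : C) (g : mor (F x) (F y)), exists f, fmor F f = g) ->
  (forall (x y : C) (f g : mor x y), fmor F f = fmor F g -> f = g) ->
  (forall d : D, exists (x : C) (e : mor d (F x)), is_iso e) ->
  equivalent_categories C D.
Proof.
intros full faithful surj.
pose (pre x y g := proj1_sig (constructive_indefinite_description _ (full x y g))).
assert (preK : forall x y g, fmor F (pre x y g) = g).
{ intros x y g; exact (proj2_sig (constructive_indefinite_description _ (full x y g))). }
(* The object, the isomorphism and its inverse are packed into one existential, so that a single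
   choice supplies all three together with both inverse laws. *)
assert (inv : forall d : D, exists t : {x : C & (mor d (F x) * mor (F x) d)%type},
  comp (snd (projT2 t)) (fst (projT2 t)) = idm d /\
  comp (fst (projT2 t)) (snd (projT2 t)) = idm (F (projT1 t))).
{ intros d; destruct (surj d) as [x [e [e' He]]].
  now exists (existT _ x (e, e')). }
pose (t d := proj1_sig (constructive_indefinite_description _ (inv d))).
pose (gob d := projT1 (t d)).
pose (e d := fst (projT2 (t d)) : mor d (F (gob d))).
pose (e' d := snd (projT2 (t d)) : mor (F (gob d)) d).
assert (e'e : forall d, comp (e' d) (e d) = idm d).
{ intros d; exact (proj1 (proj2_sig (constructive_indefinite_description _ (inv d)))). }
assert (ee' : forall d, comp (e d) (e' d) = idm (F (gob d))).
{ intros d; exact (proj2 (proj2_sig (constructive_indefinite_description _ (inv d)))). }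
clearbody e e' pre gob; clear t inv surj.
(* The quasi-inverse conjugates a morphism by the chosen isomorphisms and lifts the result along
   [F]. Its functor laws hold after applying [F], so faithfulness gives them in [C]. *)
pose (gmor (d d' : D) (m : mor d d') := pre _ _ (comp (e d') (comp m (e' d)))).
assert (gid : forall d, gmor _ _ (idm d) = idm (gob d)).
{ intros d; apply faithful; unfold gmor; rewrite preK, fmor_id.
  now rewrite comp_id_l. }
assert (gcomp : forall (a b c : D) (g : mor b c) (f : mor a b),
  gmor _ _ (comp g f) = comp (gmor _ _ g) (gmor _ _ f)).
{ intros a b c g f; apply faithful; unfold gmor; rewrite fmor_comp, !preK.
  rewrite <- !comp_assoc; do 2 f_equal.
  now rewrite (comp_assoc (e' b)), e'e, comp_id_l. }
exists F, (@Functor D C gob gmor gid gcomp); split.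
(* The isomorphism [e' (F x)] lies between objects in the image of [F], so it lifts to [C]; its
   inverse is the lift of [e (F x)]. *)
- exists (fun x => pre _ _ (e' (F x))); split; simpl.
  + intros x y f; apply faithful; unfold gmor; rewrite !fmor_comp, !preK.
    now rewrite comp_assoc, e'e, comp_id_l.
  + intros x; exists (pre _ _ (e (F x))); split; apply faithful;
      now rewrite fmor_comp, !preK, fmor_id.
- exists e'; split; simpl.
  + intros x y f; unfold gmor; rewrite preK.
    now rewrite comp_assoc, e'e, comp_id_l.
  + intros x; now exists (e x).
Qed.

(** * Consequences of the group and distributivity axioms *)

Section GroupFacts.
Context (S : signature) (E : identities S) (hC : modified_category_of_interest E).
Context (C : object E).
Implicit Types x y z : C.

Lemma addK x y : x + y - y = x.
Proof. now rewrite <- (mci_addA hC), (mci_addNr hC), (mci_add0r hC). Qed.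

Lemma subK x y : x - y + y = x.
Proof. now rewrite <- (mci_addA hC), (mci_addNl hC), (mci_add0r hC). Qed.

Lemma add_cancel_r x y z : x + z = y + z -> x = y.
Proof. intros H; now rewrite <- (addK x z), H, addK. Qed.

Lemma opp0 : - (0 : C) = 0.
Proof. now rewrite <- (mci_add0l hC (- 0)), (mci_addNr hC). Qed.

Lemma opp_unique x y : y + x = 0 -> y = - x.
Proof. intros H; apply add_cancel_r with x; now rewrite H, (mci_addNl hC). Qed.

Lemma double_eq0 x : x + x = x -> x = 0.
Proof. intros H; apply add_cancel_r with x; now rewrite (mci_add0l hC). Qed.

Lemma un0 w : un w (0 : C) = 0.
Proof. apply double_eq0; now rewrite <- (mci_unD hC), (mci_add0l hC). Qed.

Lemma bin0r o x : x *[o] 0 = 0.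
Proof. apply double_eq0; now rewrite <- (mci_binDr hC), (mci_add0l hC). Qed.

(** Only distributivity on the right is an axiom; the opposite operation carries it to the left. *)
Lemma binDl o x y z : (x + y) *[o] z = x *[o] z + y *[o] z.
Proof.
destruct (mci_opposite hC o) as [o' H].
rewrite <- !H; apply (mci_binDr hC).
Qed.

Lemma bin_add o x y z t :
  (x + y) *[o] (z + t) = x *[o] z + y *[o] z + (x *[o] t + y *[o] t).
Proof. now rewrite (mci_binDr hC), !binDl. Qed.
End GroupFacts.

(** In a group, [f 0 + f 0 = f 0] forces [f 0 = 0], and then [f (- x)] is an additive inverse of
    [f x]. *)
Lemma is_hom_of_additive (S : signature) (E : identities S)
    (hC : modified_category_of_interest E) (A B : object E) (f : A -> B) :
  (forall x y, f (x + y) = f x + f y) ->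
  (forall w x, f (un w x) = un w (f x)) ->
  (forall o x y, f (x *[o] y) = f x *[o] f y) -> is_hom f.
Proof.
intros fD fU fM.
assert (f0 : f 0 = 0).
{ apply (double_eq0 hC); now rewrite <- fD, (mci_add0l hC). }
constructor; trivial.
intros x; apply (opp_unique hC); now rewrite <- fD, (mci_addNl hC).
Qed.

(** * Split extensions as semidirect products *)

Lemma split_extension_decomp (S : signature) (E : identities S)
    (hC : modified_category_of_interest E) (A X B : object E)
    (i : hom A X) (p : hom X B) (s : hom B X) (hse : split_extension i p s)
    (x : X) :
  exists a, x = i a + s (p x).
Proof.
assert (ps : forall b, p (s b) = b).
{ intros b; exact (f_equal (fun h => hom_fun h b) (se_section hse)). }
(* The difference [x - s (p x)] is killed by [p], so exactness places it in the image of [i]. *)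
destruct (proj1 (se_exact hse (x - s (p x)))) as [a Ha].
- rewrite (hom_add (homP p)), (hom_opp (homP p)), ps; apply (mci_addNr hC).
- exists a; rewrite Ha; symmetry; apply (subK hC).
Qed.

(** The values on [A] and [B] force [h (i a + s b) = u a + v b]. The two action hypotheses say that
    conjugates and mixed products are computed in [Y] as in [X], which is what makes this formula a
    morphism. *)
Lemma split_extension_glue (S : signature) (E : identities S)
    (hC : modified_category_of_interest E) (A X B : object E)
    (i : hom A X) (p : hom X B) (s : hom B X) (hse : split_extension i p s)
    (act : action_maps B A)
    (hdot : forall b a, i (dot act b a) = (s b + i a) - s b)
    (hstar : forall o b a, i (star act o b a) = s b *[o] i a)
    (Y : object E) (u : hom A Y) (v : hom B Y)
    (udot : forall b a, u (dot act b a) = (v b + u a) - v b)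
    (ustar : forall o b a, u (star act o b a) = v b *[o] u a) :
  exists h : hom X Y, (forall a, h (i a) = u a) /\ (forall b, h (s b) = v b).
Proof.
assert (ps : forall b, p (s b) = b).
{ intros b; exact (f_equal (fun h => hom_fun h b) (se_section hse)). }
assert (pi : forall a, p (i a) = 0).
{ intros a; apply (se_exact hse); now exists a. }
pose proof (split_extension_decomp hC hse) as dec.
pose (r x := proj1_sig (constructive_indefinite_description _ (dec x))).
assert (rE : forall x, x = i (r x) + s (p x)).
{ intros x; exact (proj2_sig (constructive_indefinite_description _ (dec x))). }
clearbody r.
(* Uniqueness of the decomposition: [p] recovers [b], so [s b] cancels, and [i] is injective. *)
assert (r_glue : forall a b, r (i a + s b) = a).
{ intros a b; apply (se_inj hse); apply (add_cancel_r hC) with (s b).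
  rewrite (rE (i a + s b)) at 2.
  now rewrite (hom_add (homP p)), pi, ps, (mci_add0l hC). }
pose (h x := u (r x) + v (p x)).
assert (hE : forall a b, h (i a + s b) = u a + v b).
{ intros a b; unfold h.
  now rewrite r_glue, (hom_add (homP p)), pi, ps, (mci_add0l hC). }
clearbody h.
assert (hi : forall a, h (i a) = u a).
{ intros a; generalize (hE a 0).
  now rewrite (hom_zero (homP s)), (hom_zero (homP v)), !(mci_add0r hC). }
assert (hs : forall b, h (s b) = v b).
{ intros b; generalize (hE 0 b).
  now rewrite (hom_zero (homP i)), (hom_zero (homP u)), !(mci_add0l hC). }
assert (hD : forall x y, h (x + y) = h x + h y).
{ intros x y; rewrite (rE x), (rE y), !hE.
  generalize (r x) (p x) (r y) (p y); clear x y; intros a b a' b'.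
  assert (swapX : s b + i a' = i (dot act b a') + s b).
  { now rewrite hdot, (subK hC). }
  assert (swapY : v b + u a' = u (dot act b a') + v b).
  { now rewrite udot, (subK hC). }
  (* This is the addition of the semidirect product: moving [s b] past [i a'] turns [a'] into
     [b . a'], and the same exchange holds in [Y]. *)
  transitivity (h (i (a + dot act b a') + s (b + b'))).
  - f_equal.
    rewrite (hom_add (homP i)), (hom_add (homP s)), !(mci_addA hC).
    now rewrite <- (mci_addA hC (i a) (s b) (i a')), swapX, !(mci_addA hC).
  - rewrite hE, (hom_add (homP u)), (hom_add (homP v)), !(mci_addA hC).
    now rewrite <- (mci_addA hC (u a) (v b) (u a')), swapY, !(mci_addA hC). }
assert (hM_BA : forall o b a, h (s b *[o] i a) = h (s b) *[o] h (i a)).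
{ intros o b a; now rewrite <- hstar, !hi, hs. }
(* The action records only products with [B] on the left; the opposite operation reduces the other
   side to that case. *)
assert (hM_AB : forall o b a, h (i a *[o] s b) = h (i a) *[o] h (s b)).
{ intros o b a; destruct (mci_opposite hC o) as [o' Ho].
  rewrite <- !Ho; apply hM_BA. }
assert (hH : is_hom h).
{ apply (is_hom_of_additive hC); trivial.
  - intros w x; rewrite (rE x), (mci_unD hC), !hD, (mci_unD hC).
    now rewrite <- (hom_un (homP i)), <- (hom_un (homP s)), !hi, !hs,
      (hom_un (homP u)), (hom_un (homP v)).
  (* The product expands into four terms: two lie inside [A] or inside [B], where [u] and [v] are
     morphisms, and the two mixed ones are covered by [hM_BA] and [hM_AB]. *)
  - intros o x y; rewrite (rE x), (rE y), !(bin_add hC), !hD, !(bin_add hC).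
    rewrite hM_BA, hM_AB.
    now rewrite <- (hom_bin (homP i)), <- (hom_bin (homP s)), !hi, !hs,
      (hom_bin (homP u)), (hom_bin (homP v)). }
now exists (Hom hH).
Qed.

(** * Subobjects, kernels and fixed points *)

Record closed (S : signature) (A : algebra S) (P : A -> Prop) : Prop := Closed {
  closed_zero : P 0;
  closed_opp : forall x, P x -> P (- x);
  closed_add : forall x y, P x -> P y -> P (x + y);
  closed_un : forall w x, P x -> P (un w x);
  closed_bin : forall o x y, P x -> P y -> P (x *[o] y) }.

Definition subalgebra (S : signature) (A : algebra S) (P : A -> Prop)
    (hP : closed P) : algebra S :=
  @Algebra S (sig P) (exist _ _ (closed_zero hP))
    (fun x => exist _ _ (closed_opp hP (proj2_sig x)))
    (fun x y => exist _ _ (closed_add hP (proj2_sig x) (proj2_sig y)))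
    (fun w x => exist _ _ (closed_un hP w (proj2_sig x)))
    (fun o x y => exist _ _ (closed_bin hP o (proj2_sig x) (proj2_sig y))).

Lemma sig_ext (T : Type) (P : T -> Prop) (x y : sig P) :
  proj1_sig x = proj1_sig y -> x = y.
Proof.
destruct x as [x hx], y as [y hy]; simpl; intros ->.
now rewrite (proof_irrelevance _ hx hy).
Qed.

(** This is why a subalgebra inherits every identity of the ambient object. *)
Lemma eval_subalgebra (S : signature) (A : algebra S) (P : A -> Prop)
    (hP : closed P) (v : nat -> subalgebra hP) (t : term S) :
  proj1_sig (eval v t) = eval (fun n => proj1_sig (v n)) t.
Proof.
induction t as [n| |t IH|t IHt t' IHt'|w t IH|o t IHt t' IHt']; simpl;
  rewrite ?IH, ?IHt, ?IHt'; reflexivity.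
Qed.

Definition subobject (S : signature) (E : identities S) (C : object E)
  (P : C -> Prop) (hP : closed P) : object E.
Proof.
refine (@Object S E (subalgebra hP) _).
abstract (intros t u H v; apply sig_ext; rewrite !eval_subalgebra;
  exact (objectP H _)).
Defined.

Definition sub_incl (S : signature) (E : identities S) (C : object E)
  (P : C -> Prop) (hP : closed P) : hom (subobject hP) C :=
  Hom (IsHom (f := @proj1_sig C P : subobject hP -> C) eq_refl
    (fun _ => eq_refl) (fun _ _ => eq_refl) (fun _ _ => eq_refl)
    (fun _ _ _ => eq_refl)).

Lemma is_hom_sub_factor (S : signature) (E : identities S) (A : algebra S)
    (C : object E) (P : C -> Prop) (hP : closed P) (f : hom A C)
    (hf : forall x, P (f x)) :
  is_hom (fun x => exist P (f x) (hf x) : subobject hP).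
Proof. destruct (homP f); constructor; intros; apply sig_ext; simpl; auto. Qed.

Definition sub_factor (S : signature) (E : identities S) (A : algebra S)
    (C : object E) (P : C -> Prop) (hP : closed P) (f : hom A C)
    (hf : forall x, P (f x)) : hom A (subobject hP) :=
  Hom (is_hom_sub_factor hP hf).

Lemma closed_ker (S : signature) (E : identities S)
    (hC : modified_category_of_interest E) (A B : object E) (f : hom A B) :
  closed (fun x => f x = 0).
Proof.
destruct (homP f) as [f0 fN fD fU fM]; constructor; trivial; intros.
- rewrite fN, H; apply (opp0 hC).
- rewrite fD, H, H0; apply (mci_add0l hC).
- rewrite fU, H; apply (un0 hC).
- rewrite fM, H, H0; apply (bin0r hC).
Qed.

Lemma closed_fix (S : signature) (A : algebra S) (f : hom A A) :
  closed (fun x => f x = x).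
Proof.
destruct (homP f) as [f0 fN fD fU fM]; constructor; trivial; intros; congruence.
Qed.

(** * The functor from precat1-objects to precrossed modules *)

Section Functor.
Context (S : signature) (E : identities S) (hC : modified_category_of_interest E).

Section Object.
Context (X : precat1_object E).

Lemma pc_w01E x : pc_w0 X (pc_w1 X x) = pc_w1 X x.
Proof. exact (f_equal (fun h => hom_fun h x) (pc_w01 X)). Qed.

Lemma pc_w10E x : pc_w1 X (pc_w0 X x) = pc_w0 X x.
Proof. exact (f_equal (fun h => hom_fun h x) (pc_w10 X)). Qed.

(** Chain the two axioms: w0 w0 = w0 (w1 w0) = w1 w0 = w0. *)
Lemma pc_w00E x : pc_w0 X (pc_w0 X x) = pc_w0 X x.
Proof. now rewrite <- (pc_w10E x), pc_w01E. Qed.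

Lemma pc_w1_fix x : pc_w0 X x = x -> pc_w1 X x = x.
Proof. intros <-; apply pc_w10E. Qed.

Definition pc_ker : object E := subobject (closed_ker hC (pc_w0 X)).
(** Since w0 is idempotent, this is also the image of w0; the fixed-point form makes membership an
    equation. *)
Definition pc_fix : object E := subobject (closed_fix (pc_w0 X)).
Definition pc_ker_incl : hom pc_ker X := sub_incl (closed_ker hC (pc_w0 X)).
Definition pc_fix_incl : hom pc_fix X := sub_incl (closed_fix (pc_w0 X)).
Definition pc_proj : hom X pc_fix :=
  sub_factor (closed_fix (pc_w0 X)) pc_w00E.

Lemma pc_dot_subproof (b : pc_fix) (a : pc_ker) :
  pc_w0 X ((pc_fix_incl b + pc_ker_incl a) - pc_fix_incl b) = 0.
Proof.
destruct b as [b hb], a as [a ha]; simpl.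
rewrite !(hom_add (homP _)), (hom_opp (homP _)), ha, (mci_add0r hC).
apply (mci_addNr hC).
Qed.

Lemma pc_star_subproof o (b : pc_fix) (a : pc_ker) :
  pc_w0 X (pc_fix_incl b *[o] pc_ker_incl a) = 0.
Proof.
destruct a as [a ha]; simpl; rewrite (hom_bin (homP _)), ha; apply (bin0r hC).
Qed.

Definition pc_act : action_maps pc_fix pc_ker :=
  @ActionMaps S pc_fix pc_ker (fun b a => exist _ _ (pc_dot_subproof b a))
    (fun o b a => exist _ _ (pc_star_subproof o b a)).

Lemma pc_split_extension : split_extension pc_ker_incl pc_proj pc_fix_incl.
Proof.
constructor.
- intros a a'; apply sig_ext.
- intros x; split.
  + intros H; apply (f_equal (fun y => proj1_sig y)) in H.
    now exists (exist _ x H).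
  + intros [[a ha] <-]; now apply sig_ext.
- intros [b hb]; exists b; now apply sig_ext.
- apply hom_ext; intros [b hb]; now apply sig_ext.
Qed.

(** The witnessing extension is the object itself: it is split over the fixed points of w0 by w0 and
    the inclusion, and the action is computed inside it. *)
Lemma pc_actP : derived_action pc_act.
Proof.
exists X, pc_ker_incl, pc_proj, pc_fix_incl.
split; [exact pc_split_extension | now split].
Qed.

Definition pc_boundary : hom pc_ker pc_fix :=
  sub_factor (f := hom_comp (pc_w1 X) pc_ker_incl) (closed_fix (pc_w0 X))
    (fun x => pc_w01E (pc_ker_incl x)).

Definition px_of_pc : precrossed_module E.
Proof.
refine (@PrecrossedModule S E pc_ker pc_fix pc_act pc_actP pc_boundary _ _).
- abstract (intros [b hb] [a ha]; apply sig_ext; simpl;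
    now rewrite !(hom_add (homP _)), (hom_opp (homP _)), (pc_w1_fix hb)).
- abstract (intros o [b hb] [a ha]; apply sig_ext; simpl;
    now rewrite (hom_bin (homP _)), (pc_w1_fix hb)).
Defined.
End Object.

Section Morphism.
Context (X Y : precat1_object E) (f : pchom X Y).

Lemma pchom_w0E x : f (pc_w0 X x) = pc_w0 Y (f x).
Proof. exact (f_equal (fun h => hom_fun h x) (pchom_w0 (pchomP f))). Qed.

Lemma pchom_w1E x : f (pc_w1 X x) = pc_w1 Y (f x).
Proof. exact (f_equal (fun h => hom_fun h x) (pchom_w1 (pchomP f))). Qed.

Lemma pchom_ker (x : pc_ker X) : pc_w0 Y (f (pc_ker_incl X x)) = 0.
Proof.
destruct x as [x hx]; simpl; rewrite <- pchom_w0E, hx; apply (hom_zero (homP f)).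
Qed.

Lemma pchom_fix (x : pc_fix X) :
  pc_w0 Y (f (pc_fix_incl X x)) = f (pc_fix_incl X x).
Proof. destruct x as [x hx]; simpl; now rewrite <- pchom_w0E, hx. Qed.

Definition px_of_pc_mor : pxhom (px_of_pc X) (px_of_pc Y).
Proof.
refine (@PXHom S E (px_of_pc X) (px_of_pc Y)
  (sub_factor (f := hom_comp f (pc_ker_incl X)) (closed_ker hC (pc_w0 Y)) pchom_ker)
  (sub_factor (f := hom_comp f (pc_fix_incl X)) (closed_fix (pc_w0 Y)) pchom_fix) _).
abstract (constructor; intros; [apply hom_ext; intros | |]; apply sig_ext; simpl;
  rewrite ?(hom_add (homP f)), ?(hom_opp (homP f)), ?(hom_bin (homP f));
  trivial; apply pchom_w1E).
Defined.
End Morphism.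

Definition px_functor : functor (PreCat1 E) (PXMod E).
Proof.
refine (@Functor (PreCat1 E) (PXMod E) px_of_pc px_of_pc_mor _ _);
  abstract (intros; apply pxhom_ext; intros; now apply sig_ext).
Defined.

(** * Full faithfulness *)

Lemma pc_decomp (X : precat1_object E) (x : X) :
  exists (a : pc_ker X) (b : pc_fix X), x = pc_ker_incl X a + pc_fix_incl X b.
Proof.
destruct (split_extension_decomp hC (pc_split_extension X) x) as [a Ha].
now exists a, (pc_proj X x).
Qed.

Lemma px_functor_faithful (X Y : precat1_object E) (f g : pchom X Y) :
  px_of_pc_mor f = px_of_pc_mor g -> f = g.
Proof.
intros H; apply pchom_ext; intros x.
destruct (pc_decomp x) as [a [b ->]].
rewrite (hom_add (homP f)), (hom_add (homP g)); f_equal.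
- exact (f_equal (fun h : pxhom (px_of_pc X) (px_of_pc Y) =>
    pc_ker_incl Y (pxhom1 h a)) H).
- exact (f_equal (fun h : pxhom (px_of_pc X) (px_of_pc Y) =>
    pc_fix_incl Y (pxhom0 h b)) H).
Qed.

(** The components of [m], followed by the inclusions into [Y], are glued along the split extension
    of [X]; compatibility of [m] with the actions is exactly the gluing hypothesis. *)
Lemma px_functor_full (X Y : precat1_object E)
    (m : pxhom (px_of_pc X) (px_of_pc Y)) :
  exists f : pchom X Y, px_of_pc_mor f = m.
Proof.
destruct m as [m1 m0 [md mdot mstar]].
destruct (@split_extension_glue S E hC _ _ _ _ _ _ (pc_split_extension X)
  (pc_act X) (fun _ _ => eq_refl) (fun _ _ _ => eq_refl) Y
  (hom_comp (pc_ker_incl Y) m1) (hom_comp (pc_fix_incl Y) m0)) as [h [h1 h0]].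
- intros b a; exact (f_equal (pc_ker_incl Y) (mdot b a)).
- intros o b a; exact (f_equal (pc_ker_incl Y) (mstar o b a)).
- simpl in h1, h0.
  assert (hh : is_pchom h).
  { constructor; apply hom_ext; intros x; destruct (pc_decomp x) as [a [b ->]];
      simpl; rewrite !(hom_add (homP _)), h1, h0.
    (* On both sides w0 kills the kernel summand and fixes the other. *)
    - rewrite (proj2_sig a), (proj2_sig b), (hom_zero (homP h)), h0.
      f_equal; symmetry; [exact (proj2_sig (m1 a)) | exact (proj2_sig (m0 b))].
    (* Here w1 fixes the second summand and acts on the kernel as the boundary, so [md] settles the
       first. *)
    - rewrite (pc_w1_fix (proj2_sig b)), h0; f_equal.
      + transitivity (proj1_sig (m0 (pc_boundary X a)));
          [exact (h0 (pc_boundary X a)) |].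
        exact (f_equal (fun k : hom (pc_ker X) (pc_fix Y) => proj1_sig (k a)) md).
      + symmetry; exact (pc_w1_fix (proj2_sig (m0 b))). }
  exists (PCHom hh); apply pxhom_ext; intros x; apply sig_ext;
    [apply h1 | apply h0].
Qed.
End Functor.

(** * Isomorphisms and essential surjectivity *)

Lemma bijective_hom_inverse (S : signature) (A B : algebra S) (f : hom A B) :
  (forall a a', f a = f a' -> a = a') -> (forall b, exists a, f a = b) ->
  exists g : hom B A, (forall a, g (f a) = a) /\ (forall b, f (g b) = b).
Proof.
intros inj surj.
pose (g b := proj1_sig (constructive_indefinite_description _ (surj b))).
assert (fg : forall b, f (g b) = b).
{ intros b; exact (proj2_sig (constructive_indefinite_description _ (surj b))). }
clearbody g.
assert (hg : is_hom g).
{ destruct (homP f) as [f0 fN fD fU fM]; constructor; intros; apply inj;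
    rewrite ?f0, ?fN, ?fD, ?fU, ?fM, !fg; reflexivity. }
exists (Hom hg); split; trivial.
intros a; apply inj, fg.
Qed.

Lemma bijective_pxhom_is_iso (S : signature) (E : identities S)
    (P Q : precrossed_module E) (m : pxhom P Q) :
  (forall a a', pxhom1 m a = pxhom1 m a' -> a = a') ->
  (forall b, exists a, pxhom1 m a = b) ->
  (forall a a', pxhom0 m a = pxhom0 m a' -> a = a') ->
  (forall b, exists a, pxhom0 m a = b) ->
  is_iso (C := PXMod E) m.
Proof.
destruct m as [m1 m0 [md mdot mstar]]; simpl; intros inj1 surj1 inj0 surj0.
destruct (bijective_hom_inverse inj1 surj1) as [n1 [nm1 mn1]].
destruct (bijective_hom_inverse inj0 surj0) as [n0 [nm0 mn0]].
assert (hn : is_pxhom n1 n0).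
{ constructor.
  - apply hom_ext; intros x; simpl; apply inj0; rewrite mn0.
    generalize (f_equal (fun k => hom_fun k (n1 x)) md); simpl; intros ->.
    now rewrite mn1.
  - intros c0 c1; apply inj1; now rewrite mdot, !mn1, mn0.
  - intros o c0 c1; apply inj1; now rewrite mstar, !mn1, mn0. }
exists (PXHom hn); split; apply pxhom_ext; simpl; trivial.
Qed.

Lemma px_functor_ess_surj (S : signature) (E : identities S)
    (hC : modified_category_of_interest E) (P : precrossed_module E) :
  exists (X : precat1_object E) (m : pxhom P (px_of_pc hC X)),
    is_iso (C := PXMod E) m.
Proof.
destruct (px_actP P) as [X [i [p [s [hse [hdot hstar]]]]]].
assert (ps : forall b, p (s b) = b).
{ intros b; exact (f_equal (fun h => hom_fun h b) (se_section hse)). }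
assert (pi : forall a, p (i a) = 0).
{ intros a; apply (se_exact hse); now exists a. }
(* The precrossed module axioms are precisely the hypotheses for gluing the boundary with the
   identity of [px0 P]. *)
destruct (split_extension_glue hC hse hdot hstar (u := px_d P)
  (v := hom_id (px0 P)) (px_d_dot (p := P)) (px_d_star (p := P)))
  as [h [hi hs]]; simpl in hs.
(* The structure is w0 = s p and w1 = s h; both axioms follow from p s = 1 and h s = 1. *)
assert (w01 : hom_comp (hom_comp s p) (hom_comp s h) = hom_comp s h).
{ apply hom_ext; intros x; simpl; now rewrite ps. }
assert (w10 : hom_comp (hom_comp s h) (hom_comp s p) = hom_comp s p).
{ apply hom_ext; intros x; simpl; now rewrite hs. }
pose (X' := Precat1Object w01 w10); exists X'.
assert (k1 : forall a, pc_w0 X' (i a) = 0).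
{ intros a; simpl; rewrite pi; apply (hom_zero (homP s)). }
assert (k0 : forall b, pc_w0 X' (s b) = s b).
{ intros b; simpl; now rewrite ps. }
pose (m1 := sub_factor (closed_ker hC (pc_w0 X')) k1 : hom (px1 P) (pc_ker hC X')).
pose (m0 := sub_factor (closed_fix (pc_w0 X')) k0 : hom (px0 P) (pc_fix X')).
assert (hm : @is_pxhom S E P (px_of_pc hC X') m1 m0).
{ constructor.
  - apply hom_ext; intros a; apply sig_ext; simpl; now rewrite hi.
  - intros b a; apply sig_ext; apply hdot.
  - intros o b a; apply sig_ext; apply hstar. }
exists (PXHom hm); apply bijective_pxhom_is_iso; simpl.
- intros a a' H; apply (se_inj hse).
  exact (f_equal (fun y => proj1_sig y) H).
- intros [x hx]; simpl in hx.
  (* Membership in the kernel gives only [s (p x) = 0]; applying [p] removes the section. *)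
  assert (px : p x = 0) by now rewrite <- (ps (p x)), hx, (hom_zero (homP p)).
  destruct (proj1 (se_exact hse x) px) as [a Ha].
  exists a; now apply sig_ext.
- intros b b' H; rewrite <- (ps b), <- (ps b'); f_equal.
  exact (f_equal (fun y => proj1_sig y) H).
- intros [x hx]; exists (p x); now apply sig_ext.
Qed.

Theorem mainTheorem2 (S : signature) (E : identities S)
  (hC : modified_category_of_interest E) :
  equivalent_categories (PreCat1 E) (PXMod E).
Proof.
apply (equivalent_of_fully_faithful_ess_surj (F := px_functor hC)).
- exact (px_functor_full (hC := hC)).
- exact (px_functor_faithful (hC := hC)).
- exact (px_functor_ess_surj hC).
Qed.
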